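(* Let $r\ge2$, let $\rho_1,\ldots,\rho_r,\sigma_1,\ldots,\sigma_r$ be quantum states on a common space, and let $\varepsilon\in[0,1]$ be such that $\frac1r\sum_{i=1}^rF(\rho_i,\sigma_i)\ge1-\varepsilon$. Then $$\left|F_{\mathrm{SDP}}(\rho_1,\ldots,\rho_r)-F_{\mathrm{SDP}}(\sigma_1,\ldots,\sigma_r)\right|\le\frac{r}{r-1}\sqrt{\varepsilon(2-\varepsilon)}.$$
   Context: A quantum state is a positive semi-definite operator of unit trace on a finite-dimensional complex Hilbert space. $F(\rho,\sigma)=\|\sqrt\rho\sqrt\sigma\|_1$ is the Uhlmann (root) fidelity. The multivariate SDP fidelity is $$F_{\mathrm{SDP}}(\rho_1,\ldots,\rho_r)=\frac{1}{r(r-1)}\inf_{Y_1,\ldots,Y_r\ge0}\Big\{\sum_{i=1}^r\operatorname{Tr}[Y_i\rho_i]:\ \sum_{i=1}^r|i\rangle\langle i|\otimes Y_i\ \ge\ \sum_{i\ne j}|i\rangle\langle j|\otimes I\Big\},$$ where $\{|i\rangle\}_{i=1}^r$ is the standard basis of $\mathbb C^r$ and $\ge$ is the Loewner order. *)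

(* Defs.v *)
From mathcomp Require Import all_boot all_order all_algebra.
From mathcomp Require Import sesquilinear spectral.
From mathcomp Require Import complex mxtens.
From mathcomp Require Import classical_sets reals.

Set Implicit Arguments.
Unset Strict Implicit.
Unset Printing Implicit Defensive.

Import Order.TTheory GRing.Theory Num.Theory.
Local Open Scope ring_scope.
Local Open Scope sesquilinear_scope.
Local Open Scope complex_scope.
Local Open Scope classical_set_scope.

(* In R[i], [0 <= z] means that z is real and nonnegative. *)
Definition psdmx (R : realType) (n : nat) (A : 'M[R[i]]_n) : Prop :=
  A \is hermsymmx /\ forall v : 'cV[R[i]]_n, 0 <= (v^t* *m A *m v) 0 0.

Definition loewner_le (R : realType) (n : nat) (A B : 'M[R[i]]_n) : Prop :=
  psdmx (B - A).

Definition quantum_state (R : realType) (d : nat) (rho : 'M[R[i]]_d) : Prop :=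
  psdmx rho /\ \tr rho = 1.

(* Functional calculus: A = U^-1 diag(X) U with U unitary whenever A is normal;
   the value is only meaningful for positive semi-definite A. *)
Definition sqrtmx (R : realType) (n : nat) (A : 'M[R[i]]_n) : 'M[R[i]]_n :=
  invmx (spectralmx A)
    *m diag_mx (map_mx sqrtC (spectral_diag A))
    *m spectralmx A.

(* The trace is a nonnegative real element of R[i]; complex.Re reads it in R. *)
Definition trace_norm (R : realType) (n : nat) (A : 'M[R[i]]_n) : R :=
  complex.Re (\tr (sqrtmx (A^t* *m A))).

Definition fidelity (R : realType) (d : nat) (rho sigma : 'M[R[i]]_d) : R :=
  trace_norm (sqrtmx rho *m sqrtmx sigma).

(* [delta_mx i j] is |i><j| and [*t] is the Kronecker product. *)
Definition sdp_feasible (R : realType) (d r : nat) (Y : 'I_r -> 'M[R[i]]_d) :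
    Prop :=
  (forall i, psdmx (Y i)) /\
  loewner_le
    (\sum_(i < r) \sum_(j < r | i != j)
        ((delta_mx i j : 'M[R[i]]_r) *t (1%:M : 'M[R[i]]_d)))
    (\sum_(i < r) ((delta_mx i i : 'M[R[i]]_r) *t Y i)).

(* The infimum is taken in R: for states, each Tr[Y_i rho_i] is a nonnegative
   real, and the set of values is nonempty and bounded below by 0. *)
Definition sdp_fidelity (R : realType) (d r : nat) (rho : 'I_r -> 'M[R[i]]_d) :
    R :=
  (r%:R * (r%:R - 1))^-1 *
  inf [set x : R | exists2 Y : 'I_r -> 'M[R[i]]_d, sdp_feasible Y &
                     x = \sum_(i < r) complex.Re (\tr (Y i *m rho i))].

(* Main.v *)
(** The Loewner constraint with [Z_i = Y_i + I] says that
    [|sum_i u_i|^2 <= sum_i <u_i, Z_i u_i>] for all vectors [u_i].  Given [Y]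
    feasible for [sigma], the proof builds a point feasible for [rho], without
    SDP duality.  Let [K] be the product of the two square roots and [V] the
    partial isometry of its polar decomposition, put [A_i = sqrt(sigma_i) V_i]
    and [B_i = sqrt(rho_i) + h I] with [h > 0] small, so that
    [Re Tr(A_i^* B_i)] is close to [F(rho_i, sigma_i)].  For real [a, b] with
    [a^2 - b^2 = 1], set [X_i = a B_i - b A_i] and
    [Z'_i = B_i^{-*} (A_i^* Z_i A_i + r X_i^* X_i) B_i^{-1}].
    Since [|p|^2 <= |q|^2 + |a p - b q|^2] and [|sum_i z_i|^2 <= r sum_i |z_i|^2],
    [Z'] is again feasible, and its value exceeds that of [Z] by at most
    [r sum_i (a^2 + b^2 - 2 a b F(rho_i, sigma_i))] up to a vanishing error.
    Optimising over the hyperbola [a^2 - b^2 = 1] gives [r^2 sqrt(eps (2 - eps))]. *)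

Require Import Defs.
From mathcomp Require Import all_boot all_order all_algebra.
From mathcomp Require Import complex reals.
From mathcomp Require Import sesquilinear spectral mxtens classical_sets.
From mathcomp Require Import ring lra.

Set Implicit Arguments.
Unset Strict Implicit.
Unset Printing Implicit Defensive.

Import Order.TTheory GRing.Theory Num.Theory.
Local Open Scope ring_scope.
Local Open Scope sesquilinear_scope.

(** * Algebra of the conjugate transpose and traces of Gram matrices *)

Section Adjoint.
Variable C : numClosedFieldType.

Lemma adjmxM m n p (A : 'M[C]_(m, n)) (B : 'M[C]_(n, p)) :
  (A *m B)^t* = B^t* *m A^t*.
Proof. by rewrite trmx_mul map_mxM. Qed.

Lemma adjmxD m n (A B : 'M[C]_(m, n)) : (A + B)^t* = A^t* + B^t*.
Proof. by rewrite linearD map_mxD. Qed.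

Lemma adjmxB m n (A B : 'M[C]_(m, n)) : (A - B)^t* = A^t* - B^t*.
Proof. by rewrite linearB map_mxB. Qed.

Lemma adjmxZ m n (a : C) (A : 'M[C]_(m, n)) : (a *: A)^t* = a^* *: A^t*.
Proof. by rewrite linearZ map_mxZ. Qed.

Lemma adjmx1 n : (1%:M : 'M[C]_n)^t* = 1%:M.
Proof. by rewrite trmx1 map_mx1. Qed.

Lemma adjmx_sum (I : finType) m n (A : I -> 'M[C]_(m, n)) :
  (\sum_i A i)^t* = \sum_i (A i)^t*.
Proof. by rewrite raddf_sum map_mx_sum. Qed.

Lemma hermsymmxP n (A : 'M[C]_n) : reflect (A^t* = A) (A \is hermsymmx).
Proof.
apply: (iffP (is_hermitianmxP _ _ _)); rewrite expr0 scale1r => hA.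
  exact: esym.
exact: esym.
Qed.

Lemma tr_adjmx n (A : 'M[C]_n) : \tr (A^t*) = (\tr A)^*.
Proof. by rewrite rmorph_sum; apply: eq_bigr => i _; rewrite !mxE. Qed.

Lemma tr_gram_ge0 m n (A : 'M[C]_(m, n)) : 0 <= \tr (A^t* *m A).
Proof.
apply: sumr_ge0 => i _; rewrite mxE; apply: sumr_ge0 => j _.
by rewrite !mxE mulrC mul_conjC_ge0.
Qed.

Lemma gram_ge0 m (v : 'cV[C]_m) : 0 <= (v^t* *m v) 0 0.
Proof. by rewrite -trace_mx11 tr_gram_ge0. Qed.

Lemma mxtraceB n (A B : 'M[C]_n) :
  \tr (A - B) = \tr A - \tr B.
Proof. exact: raddfB. Qed.

Lemma tr_gram_comb m n (A B : 'M[C]_(m, n)) (x y : C) :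
  \tr ((x *: B - y *: A)^t* *m (x *: B - y *: A)) =
  Num.conj x * (x * \tr (B^t* *m B)) + Num.conj y * (y * \tr (A^t* *m A))
   - (Num.conj y * (x * \tr (A^t* *m B)) + Num.conj x * (y * \tr (B^t* *m A))).
Proof.
rewrite adjmxB !adjmxZ mulmxBl !mulmxBr -!scalemxAl -!scalemxAr.
rewrite !mxtraceB !mxtraceZ; ring.
Qed.

Lemma tr_perturb n (A B : 'M[C]_n) (x : C) :
  \tr (A + ((x *+ 2) *: B + (x ^+ 2)%:M)) =
  \tr A + x * (\tr B + \tr B) + x * (x * n%:R).
Proof. by rewrite !mxtraceD mxtraceZ mxtrace_scalar -mulr_natr; ring. Qed.

End Adjoint.

(** * Two inequalities for squared norms of vectors *)

Section NormInequalities.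
Variable C : numClosedFieldType.

(** Summing [|z_i - z_j|^2 >= 0] over all ordered pairs gives twice the difference of the two
    sides. *)
Lemma normsq_sum_le (r n : nat) (z : 'I_r -> 'cV[C]_n) :
  ((\sum_i z i)^t* *m (\sum_i z i)) 0 0 <= r%:R * \sum_i ((z i)^t* *m z i) 0 0.
Proof.
pose f i j := ((z i)^t* *m z j) 0 0.
have -> : ((\sum_i z i)^t* *m (\sum_i z i)) 0 0 = \sum_i \sum_j f i j.
  rewrite adjmx_sum mulmx_suml summxE; apply: eq_bigr => i _.
  by rewrite mulmx_sumr summxE.
have : 0 <= \sum_i \sum_j ((z i - z j)^t* *m (z i - z j)) 0 0.
  by apply: sumr_ge0 => i _; apply: sumr_ge0 => j _; apply: gram_ge0.
have fE i j : ((z i - z j)^t* *m (z i - z j)) 0 0 = f i i + f j j - (f i j + f j i).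
  by rewrite /f -!trace_mx11 adjmxB mulmxBl !mulmxBr !mxtraceB; ring.
under eq_bigr do under eq_bigr do rewrite fE.
under eq_bigr do rewrite sumrB !big_split /= sumr_const card_ord.
rewrite sumrB !big_split /= sumr_const card_ord.
rewrite [X in _ - (_ + X)]exchange_big /= -sumrMnl mulr_natl.
rewrite -!mulr2n -mulrnBl pmulrn_lge0 // subr_ge0.
by rewrite sumrMnl.
Qed.

(** The right side minus the left side is exactly [|b p - a q|^2]. *)
Lemma normsq_hyperbolic n (p q : 'cV[C]_n) (a b : C) :
  a \is Num.real -> b \is Num.real -> a ^+ 2 - b ^+ 2 = 1 ->
  (p^t* *m p) 0 0 <= (q^t* *m q) 0 0 + ((a *: p - b *: q)^t* *m (a *: p - b *: q)) 0 0.
Proof.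
move=> /CrealP aR /CrealP bR ab; rewrite -subr_ge0.
have := gram_ge0 (b *: p - a *: q).
rewrite -!trace_mx11 !tr_gram_comb aR bR.
move: (\tr _) (\tr _) (\tr _) (\tr _) => P Q S T H.
have aE : a ^+ 2 = 1 + b ^+ 2 by rewrite -ab; ring.
apply: le_trans H _; rewrite le_eqVlt; apply/orP; left; apply/eqP.
by ring: aE.
Qed.

End NormInequalities.

Local Open Scope complex_scope.

(** * Positive semi-definite matrices, square roots, polar decomposition *)

Section PositiveSemidefinite.
Variable R : realType.
Implicit Types n : nat.

Lemma psdmx_gram m n (S : 'M[R[i]]_(m, n)) : psdmx (S^t* *m S).
Proof.
split; first by apply/hermsymmxP; rewrite adjmxM trmxCK.
by move=> v; rewrite !mulmxA -mulmxA -adjmxM gram_ge0.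
Qed.

Lemma psdmxD n (A B : 'M[R[i]]_n) : psdmx A -> psdmx B -> psdmx (A + B).
Proof.
move=> [/hermsymmxP hA pA] [/hermsymmxP hB pB]; split.
  by apply/hermsymmxP; rewrite adjmxD hA hB.
by move=> v; rewrite mulmxDr mulmxDl mxE addr_ge0.
Qed.

Lemma psdmxZ n (a : R[i]) (A : 'M[R[i]]_n) : 0 <= a -> psdmx A -> psdmx (a *: A).
Proof.
move=> a0 [/hermsymmxP hA pA]; split.
  by apply/hermsymmxP; rewrite adjmxZ hA (CrealP (ger0_real a0)).
by move=> v; rewrite -scalemxAr -scalemxAl mxE mulr_ge0.
Qed.

Lemma psdmx_conj m n (A : 'M[R[i]]_n) (X : 'M[R[i]]_(n, m)) :
  psdmx A -> psdmx (X^t* *m A *m X).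
Proof.
move=> [/hermsymmxP hA pA]; split.
  by apply/hermsymmxP; rewrite !adjmxM trmxCK hA mulmxA.
by move=> v; have := pA (X *m v); rewrite adjmxM !mulmxA.
Qed.

Lemma psdmx1 n : psdmx (1%:M : 'M[R[i]]_n).
Proof. by have := psdmx_gram (1%:M : 'M[R[i]]_n); rewrite adjmx1 mulmx1. Qed.

Lemma psdmx_proj n (P : 'M[R[i]]_n) : P^t* = P -> P *m P = P -> psdmx P.
Proof. by move=> hP PP; rewrite -PP -{1}hP; apply: psdmx_gram. Qed.

Lemma psdmx_compl_proj n (P : 'M[R[i]]_n) :
  P^t* = P -> P *m P = P -> psdmx (1%:M - P).
Proof.
move=> hP PP; apply: psdmx_proj; first by rewrite adjmxB adjmx1 hP.
by rewrite mulmxBl !mulmxBr !mul1mx mulmx1 PP subrr subr0.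
Qed.

Lemma adj_diag_mx n (D : 'rV[R[i]]_n) :
  (forall i, 0 <= D 0 i) -> (diag_mx D)^t* = diag_mx D.
Proof.
move=> D0; rewrite tr_diag_mx map_diag_mx; congr diag_mx.
by apply/rowP => i; rewrite mxE; apply/CrealP/ger0_real/D0.
Qed.

Lemma psdmx_diag n (D : 'rV[R[i]]_n) : (forall i, 0 <= D 0 i) -> psdmx (diag_mx D).
Proof.
move=> D0; have D1 i : 0 <= (map_mx sqrtC D) 0 i by rewrite mxE sqrtC_ge0.
have -> : diag_mx D = (diag_mx (map_mx sqrtC D))^t* *m diag_mx (map_mx sqrtC D).
  rewrite (adj_diag_mx D1) mulmx_diag; congr diag_mx.
  by apply/rowP => i; rewrite !mxE -expr2 sqrtCK.
exact: psdmx_gram.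
Qed.

Lemma adj_psdmx n (A : 'M[R[i]]_n) : psdmx A -> A^t* = A.
Proof. by case=> /hermsymmxP. Qed.

Lemma unitary_conjK m n (W X : 'M[R[i]]_n) (Y : 'M[R[i]]_(m, n)) :
  W *m W^t* = 1%:M -> Y *m W *m (W^t* *m X *m W) = Y *m X *m W.
Proof. by move=> WW; rewrite !mulmxA -(mulmxA Y) WW mulmx1. Qed.

(** With [Y = W^t*] this is the functional calculus: matrices diagonal in one eigenbasis multiply
    eigenvalue by eigenvalue. *)
Lemma unitary_diagM m n (W : 'M[R[i]]_n) (Y : 'M[R[i]]_(m, n)) (D E F : 'rV[R[i]]_n) :
  W *m W^t* = 1%:M -> (forall i, D 0 i * E 0 i = F 0 i) ->
  Y *m diag_mx D *m W *m (W^t* *m diag_mx E *m W) = Y *m diag_mx F *m W.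
Proof.
move=> WW DEF; rewrite (unitary_conjK _ _ WW) -(mulmxA Y) mulmx_diag.
by have -> : \row_j (D 0 j * E 0 j) = F by apply/rowP => i; rewrite mxE DEF.
Qed.

Lemma psdmx_spectral n (A : 'M[R[i]]_n) : psdmx A ->
  exists (W : 'M[R[i]]_n) (D : 'rV[R[i]]_n),
    [/\ W *m W^t* = 1%:M, forall i, 0 <= D 0 i,
        A = W^t* *m diag_mx D *m W
      & sqrtmx A = W^t* *m diag_mx (map_mx sqrtC D) *m W].
Proof.
move=> [hA pA]; rewrite /sqrtmx.
have /unitarymxP := spectral_unitarymx A.
have := invmx_unitary (spectral_unitarymx A).
have /= := hermitian_normalmx hA => /orthomx_spectralP.
move: (spectralmx A) (spectral_diag A) => W D AE WV WW.
rewrite WV in AE *; exists W, D; split=> // i.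
(* The form of [A] at the eigenvector [W^t* *m e] is the eigenvalue [D 0 i]. *)
pose e : 'cV[R[i]]_n := delta_mx i 0.
have := pA (W^t* *m e); rewrite AE adjmxM trmxCK (unitary_conjK _ _ WW).
rewrite mulmxA -(mulmxA _ W) WW mulmx1.
by rewrite trmx_delta map_delta_mx -rowE -colE !mxE eqxx mulr1n.
Qed.

Lemma psdmx_sqrtmx n (A : 'M[R[i]]_n) : psdmx A -> psdmx (sqrtmx A).
Proof.
move=> /psdmx_spectral [W [D [_ D0 _ ->]]]; apply/psdmx_conj/psdmx_diag => i.
by rewrite mxE sqrtC_ge0.
Qed.

Lemma sqrtmxK n (A : 'M[R[i]]_n) : psdmx A -> sqrtmx A *m sqrtmx A = A.
Proof.
move=> /psdmx_spectral [W [D [WW D0 AE ->]]]; rewrite {}[in RHS]AE.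
by apply: unitary_diagM => // i; rewrite !mxE -expr2 sqrtCK.
Qed.

(** The shift lifts every eigenvalue of the root to at least [h], so even a singular state yields an
    invertible factor. *)
Lemma sqrtmxD_unit n (A : 'M[R[i]]_n) (h : R[i]) : psdmx A -> 0 < h ->
  sqrtmx A + h%:M \in unitmx.
Proof.
move=> /psdmx_spectral [W [D [WW D0 _ ->]]] h0.
have [uW uV] := mulmx1_unit WW; have VW := mulmx1C WW.
have -> : h%:M = W^t* *m h%:M *m W.
  by rewrite mul_mx_scalar -scalemxAl VW scalemx1.
rewrite -mulmxDl -mulmxDr -diag_const_mx -linearD /= !unitmx_mul uW uV /= andbT.
rewrite unitmxE det_diag unitfE; apply/prodf_neq0 => i _.
by rewrite !mxE gt_eqF // ltr_wpDl // sqrtC_ge0.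
Qed.

Lemma psdmx_factor n (A : 'M[R[i]]_n) : psdmx A ->
  exists S : 'M[R[i]]_n, A = S *m S^t*.
Proof.
move=> pA; exists (sqrtmx A).
by rewrite (adj_psdmx (psdmx_sqrtmx pA)) sqrtmxK.
Qed.

(** For [A = S S^*] and [B = T T^*] the trace is the squared Hilbert-Schmidt norm of [S^* T]. *)
Lemma tr_mul_psdmx_ge0 n (A B : 'M[R[i]]_n) : psdmx A -> psdmx B -> 0 <= \tr (A *m B).
Proof.
move=> /psdmx_factor [S ->] /psdmx_factor [T ->].
have := tr_gram_ge0 (S^t* *m T).
by rewrite adjmxM trmxCK -!mulmxA mxtrace_mulC -!mulmxA mxtrace_mulC !mulmxA.
Qed.

(* Polar decomposition; [0^-1 = 0] makes the isometric factor vanish on the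
   kernel of [K]. *)
Lemma polar_contraction n (K : 'M[R[i]]_n) : exists V : 'M[R[i]]_n,
  [/\ psdmx (1%:M - V *m V^t*), psdmx (1%:M - V^t* *m V)
    & \tr (V^t* *m K) = \tr (sqrtmx (K^t* *m K))].
Proof.
have [W [L [WW L0 KK ->]]] := psdmx_spectral (psdmx_gram K).
pose D : 'rV[R[i]]_n := map_mx (fun x => (sqrtC x)^-1) L.
have hD : (diag_mx D)^t* = diag_mx D.
  by apply: adj_diag_mx => i; rewrite mxE invr_ge0 sqrtC_ge0.
(* [V] is [K] times the pseudo-inverse of [|K| = sqrt(K^* K)]. *)
pose V := K *m (W^t* *m diag_mx D *m W).
have VK : V^t* *m K = W^t* *m diag_mx (map_mx sqrtC L) *m W.
  rewrite /V !adjmxM trmxCK hD -(mulmxA _ (K^t*)) KK (mulmxA (W^t*)).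
  apply: unitary_diagM => // i; rewrite !mxE.
  have [->|x0] := eqVneq (L 0 i) 0; first by rewrite sqrtC0 mulr0.
  by rewrite -{2}(sqrtCK (L 0 i)) expr2 mulKf // sqrtC_eq0.
(* [P] marks the nonzero eigenvalues, so [V^* V] projects onto the support of [|K|]. Then
   [V V^* V = V] makes both [V^* V] and [V V^*] projections. *)
pose P : 'rV[R[i]]_n := \row_i (L 0 i != 0)%:R.
have VV : V^t* *m V = W^t* *m diag_mx P *m W.
  rewrite {2}/V mulmxA VK; apply: unitary_diagM => // i; rewrite !mxE.
  have [->|x0] := eqVneq (L 0 i) 0; first by rewrite sqrtC0 mul0r.
  by rewrite mulfV // sqrtC_eq0.
have VVV : V *m (V^t* *m V) = V.
  rewrite VV /V -(mulmxA K).
  rewrite (@unitary_diagM _ _ _ _ _ _ D WW) // => i; rewrite !mxE.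
  have [->|x0] := eqVneq (L 0 i) 0; first by rewrite sqrtC0 invr0 mul0r.
  by rewrite mulr1.
exists V; split; last by rewrite VK.
- apply: psdmx_compl_proj; first by rewrite adjmxM trmxCK.
  by rewrite mulmxA -(mulmxA V) VVV.
- apply: psdmx_compl_proj; first by rewrite adjmxM trmxCK.
  by rewrite -mulmxA VVV.
Qed.

End PositiveSemidefinite.

(** * Real parts in [R[i]] *)

Section RealPart.
Variable R : realType.

Lemma ReD (x y : R[i]) : complex.Re (x + y) = complex.Re x + complex.Re y.
Proof. by case: x y => [a b] [c d]. Qed.

Lemma ReN (x : R[i]) : complex.Re (- x) = - complex.Re x.
Proof. by case: x. Qed.

Lemma ReZ (a : R) (x : R[i]) : complex.Re (a%:C * x) = a * complex.Re x.
Proof. by case: x => [b c] /=; rewrite mul0r subr0. Qed.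

Lemma Re_conj (x : R[i]) : complex.Re (Num.conj x) = complex.Re x.
Proof. by case: x. Qed.

Lemma Re_nat n : complex.Re (n%:R : R[i]) = n%:R.
Proof. by elim: n => // n IHn; rewrite !mulrS ReD IHn. Qed.

Lemma Re_ge0 (x : R[i]) : 0 <= x -> 0 <= complex.Re x.
Proof. by rewrite lecE => /andP []. Qed.

Lemma conjC_real (a : R) : Num.conj (a%:C) = a%:C.
Proof. by rewrite conj_Creal // complex_real. Qed.

End RealPart.

(** * Factors of a pair of states that nearly realise the fidelity *)

Section FidelityPair.
Variable R : realType.
Variable d : nat.
Implicit Types A B V rho sigma : 'M[R[i]]_d.

Lemma Re_tr_adj A : complex.Re (\tr (A^t*)) = complex.Re (\tr A).
Proof. by rewrite tr_adjmx Re_conj. Qed.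

Lemma Re_tr_gram_comb A B (a b p q t : R) :
  complex.Re (\tr (B^t* *m B)) = p -> complex.Re (\tr (A^t* *m A)) = q ->
  complex.Re (\tr (A^t* *m B)) = t ->
  complex.Re (\tr ((a%:C *: B - b%:C *: A)^t* *m (a%:C *: B - b%:C *: A)))
  = a ^+ 2 * p + b ^+ 2 * q - a * b * t *+ 2.
Proof.
move=> Ep Eq Et.
have Et' : complex.Re (\tr (B^t* *m A)) = t.
  by rewrite -Et -[RHS]Re_tr_adj adjmxM trmxCK.
rewrite tr_gram_comb !conjC_real !(ReD, ReN, ReZ) Ep Eq Et Et'; ring.
Qed.

(** For [h <= 1] one has [h^2 <= h], so [h * (|p| + |q| + 1) <= e] suffices; the [1] keeps the
    divisor positive. *)
Lemma quadratic_small (p q e : R) : 0 < e ->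
  exists2 h : R, 0 < h & h * p + h ^+ 2 * q <= e.
Proof.
move=> e0; pose k := `|p| + `|q| + 1.
have k1 : 0 < k by rewrite /k ltr_wpDl // addr_ge0.
have pk : p <= `|p| by exact: ler_norm.
have qk : q <= `|q| by exact: ler_norm.
have p0 := normr_ge0 p; have q0 := normr_ge0 q.
exists (Num.min 1 (e / k)); first by rewrite lt_min ltr01 divr_gt0.
set h := Num.min _ _.
have h0 : 0 < h by rewrite lt_min ltr01 divr_gt0.
have h1 : h <= 1 by rewrite ge_min lexx.
have h2 : h * k <= e by rewrite -ler_pdivlMr // ge_min lexx orbT.
have hh : h ^+ 2 * q <= h * `|q|.
  by rewrite expr2 -mulrA ler_pM2l //; nra.
have hp : h * p <= h * `|p| by rewrite ler_pM2l.
rewrite /k in h2; nra.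
Qed.

Lemma contraction_factors rho sigma V (a b e : R) :
  quantum_state rho -> quantum_state sigma -> psdmx (1%:M - V *m V^t*) ->
  0 < e ->
  exists A B, [/\ B \in unitmx, psdmx (B *m B^t* - rho), psdmx (sigma - A *m A^t*)
    & complex.Re (\tr ((a%:C *: B - b%:C *: A)^t* *m (a%:C *: B - b%:C *: A)))
      <= a ^+ 2 + b ^+ 2
         - a * b * complex.Re (\tr (V^t* *m (sqrtmx sigma *m sqrtmx rho))) *+ 2 + e].
Proof.
move=> [prho trrho] [psigma trsigma] pV e0.
have pS := psdmx_sqrtmx psigma; have pT := psdmx_sqrtmx prho.
have SS := sqrtmxK psigma; have TT := sqrtmxK prho.
have U h := sqrtmxD_unit (h := h) prho.
move: (sqrtmx sigma) (sqrtmx rho) pS pT SS TT U => S T pS pT SS TT U.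
have hS := adj_psdmx pS; have hT := adj_psdmx pT.
pose A := S *m V.
have pA : psdmx (sigma - A *m A^t*).
  have := psdmx_conj S pV.
  by rewrite hS mulmxBr mulmx1 mulmxBl SS /A adjmxM hS !mulmxA.
have AA : complex.Re (\tr (A^t* *m A)) <= 1.
  rewrite mxtrace_mulC -subr_ge0 -ReN.
  have -> : 1 = complex.Re (\tr sigma) by rewrite trsigma.
  rewrite -ReD -mxtraceB; apply: Re_ge0.
  by have := tr_mul_psdmx_ge0 pA (psdmx1 R d); rewrite mulmx1.
(* [p] and [a ^+ 2 * d%:R] are the coefficients of [h] and [h ^+ 2] that the shift adds to the
   expanded trace; [h] keeps their total below [e]. *)
pose p := a ^+ 2 * (complex.Re (\tr T) *+ 2) - a * b * complex.Re (\tr A) *+ 2.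
have [h h0 hpq] := quadratic_small p (a ^+ 2 * d%:R) e0.
have hC : 0 < h%:C :> R[i] by rewrite ltcR.
pose B := T + (h%:C)%:M.
have hB : B^t* = B.
  by rewrite /B adjmxD hT -scalemx1 adjmxZ conjC_real adjmx1.
have BB : B *m B = T *m T + ((h%:C *+ 2) *: T + (h%:C ^+ 2)%:M).
  rewrite /B mulmxDl !mulmxDr mul_scalar_mx mul_mx_scalar -scalar_mxM -expr2.
  by rewrite mulr2n scalerDl !addrA.
exists A, B; split.
- exact: U.
- rewrite hB BB TT addrC addKr; apply: psdmxD.
    by apply: psdmxZ pT; rewrite mulrn_wge0 // ltW.
  by rewrite -scalemx1; apply: psdmxZ (psdmx1 _ _); rewrite exprn_ge0 // ltW.
- exact: pA.
have trB : complex.Re (\tr (B^t* *m B))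
   = 1 + h * complex.Re (\tr T) *+ 2 + h ^+ 2 * d%:R.
  rewrite hB BB TT tr_perturb trrho !ReD !ReZ.
  by rewrite Re_nat /=; ring.
have trAB : complex.Re (\tr (A^t* *m B)) =
  complex.Re (\tr (V^t* *m (S *m T))) + h * complex.Re (\tr A).
  rewrite /B mulmxDr mxtraceD mul_mx_scalar mxtraceZ ReD ReZ Re_tr_adj.
  by rewrite {1}/A adjmxM hS -mulmxA.
rewrite (Re_tr_gram_comb a b trB erefl trAB).
(* As [V] is only a contraction, [Tr(A^* A)] may fall below 1; its weight [b ^+ 2] is nonnegative,
   so the bound by 1 is enough. *)
have := mulr_ge0 (sqr_ge0 b) (etrans (subr_ge0 _ _) AA).
rewrite /p in hpq; lra.
Qed.

Lemma fidelity_contractionr rho sigma : psdmx rho -> psdmx sigma ->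
  exists2 V, psdmx (1%:M - V *m V^t*) &
    complex.Re (\tr (V^t* *m (sqrtmx rho *m sqrtmx sigma))) = fidelity rho sigma.
Proof.
move=> prho psigma.
have [V [pV _ trV]] := polar_contraction (sqrtmx rho *m sqrtmx sigma).
by exists V => //; rewrite trV.
Qed.

(** The adjoint of the polar factor serves this reversed order of the roots: taking adjoints and
    cycling preserve the real part of the trace. Both orders occur because the final estimate is
    applied in both directions. *)
Lemma fidelity_contractionl rho sigma : psdmx rho -> psdmx sigma ->
  exists2 V, psdmx (1%:M - V *m V^t*) &
    complex.Re (\tr (V^t* *m (sqrtmx sigma *m sqrtmx rho))) = fidelity rho sigma.
Proof.
move=> prho psigma.
have [V [_ pV trV]] := polar_contraction (sqrtmx rho *m sqrtmx sigma).
exists (V^t*); first by rewrite trmxCK.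
rewrite /fidelity /trace_norm -trV.
have hS := adj_psdmx (psdmx_sqrtmx psigma).
have hT := adj_psdmx (psdmx_sqrtmx prho).
move: (sqrtmx rho) (sqrtmx sigma) hS hT => T S hS hT.
by rewrite -Re_tr_adj !adjmxM !trmxCK hS hT mxtrace_mulC.
Qed.

End FidelityPair.

(** * The Loewner constraint as inequalities between vectors *)

Section BlockForm.
Variables (R : realType) (r d : nat).
Local Notation C := R[i].
Implicit Types (u : 'I_r -> 'cV[C]_d).

Lemma sum_mxtens_index (F : 'I_(r * d) -> C) :
  \sum_p F p = \sum_i \sum_k F (mxtens_index (i, k)).
Proof.
rewrite pair_bigA /= (reindex (@mxtens_index r d)) /=; last first.
  exists (@mxtens_unindex r d) => x _; first exact: mxtens_indexK.
  exact: mxtens_unindexK.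
by apply: eq_bigr => -[].
Qed.

Definition block (v : 'cV[C]_(r * d)) (i : 'I_r) : 'cV[C]_d :=
  \col_k v (mxtens_index (i, k)) 0.

Definition unblock u : 'cV[C]_(r * d) :=
  \col_p u (mxtens_unindex p).1 (mxtens_unindex p).2 0.

Lemma unblockK u i : block (unblock u) i = u i.
Proof. by apply/colP => k; rewrite !mxE mxtens_indexK. Qed.

Lemma formE n (x y : 'cV[C]_n) (B : 'M[C]_n) :
  (x^t* *m B *m y) 0 0 = \sum_k \sum_l Num.conj (x k 0) * B k l * y l 0.
Proof.
rewrite mxE exchange_big /=; apply: eq_bigr => l _.
by rewrite mxE mulr_suml; apply: eq_bigr => k _; rewrite !mxE.
Qed.

Lemma tensmx_form (A : 'M[C]_r) (B : 'M[C]_d) (v : 'cV[C]_(r * d)) :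
  (v^t* *m (A *t B) *m v) 0 0 =
  \sum_i \sum_j A i j * ((block v i)^t* *m B *m block v j) 0 0.
Proof.
rewrite formE sum_mxtens_index; apply: eq_bigr => i _.
under eq_bigr do rewrite sum_mxtens_index.
rewrite exchange_big /=; apply: eq_bigr => j _.
rewrite formE mulr_sumr; apply: eq_bigr => k _.
rewrite mulr_sumr; apply: eq_bigr => l _.
by rewrite tensmxE !mxE; ring.
Qed.

Lemma delta_tensmx_form (a b : 'I_r) (B : 'M[C]_d) (v : 'cV[C]_(r * d)) :
  (v^t* *m ((delta_mx a b : 'M[C]_r) *t B) *m v) 0 0 =
  ((block v a)^t* *m B *m block v b) 0 0.
Proof.
rewrite tensmx_form (bigD1 a) //= [X in _ + X]big1 ?addr0; last first.
  move=> i /negPf ia; rewrite big1 // => j _.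
  by rewrite mxE ia mul0r.
rewrite (bigD1 b) //= big1 ?addr0 => [|j /negPf jb]; last first.
  by rewrite mxE jb andbF mul0r.
by rewrite mxE !eqxx mul1r.
Qed.

Lemma form_sum (I : finType) (P : pred I) n (x : 'cV[C]_n) (B : I -> 'M[C]_n) :
  (x^t* *m (\sum_(i | P i) B i) *m x) 0 0 = \sum_(i | P i) (x^t* *m B i *m x) 0 0.
Proof. by rewrite mulmx_sumr mulmx_suml summxE. Qed.

Lemma normsq_sum u :
  ((\sum_i u i)^t* *m (\sum_i u i)) 0 0 = \sum_i \sum_j ((u i)^t* *m u j) 0 0.
Proof.
rewrite adjmx_sum mulmx_suml summxE; apply: eq_bigr => i _.
by rewrite mulmx_sumr summxE.
Qed.

(** The added identity supplies the diagonal terms of [|sum_i u_i|^2], which the sum over [i != j]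
    omits. *)
Definition sdp_gap (Y : 'I_r -> 'M[C]_d) u : C :=
  \sum_i ((u i)^t* *m (Y i + 1%:M) *m u i) 0 0
  - ((\sum_i u i)^t* *m (\sum_i u i)) 0 0.

Lemma sdp_gapE (Y : 'I_r -> 'M[C]_d) (v : 'cV[C]_(r * d)) :
  (v^t* *m (\sum_(i < r) ((delta_mx i i : 'M[C]_r) *t Y i)
    - \sum_(i < r) \sum_(j < r | i != j)
        ((delta_mx i j : 'M[C]_r) *t (1%:M : 'M[C]_d))) *m v) 0 0
  = sdp_gap Y (block v).
Proof.
rewrite mulmxBr mulmxBl [LHS]mxE.
rewrite  [X in _ + X]mxE.
rewrite !form_sum /sdp_gap normsq_sum.
rewrite -!sumrB; apply: eq_bigr => i _.
rewrite delta_tensmx_form form_sum [X in _ = _ - X](bigD1 i) //=.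
rewrite mulmxDr mulmxDl mulmx1 [in RHS]mxE.
rewrite opprD addrA addrK; congr (_ - _); apply: eq_big => j.
  by rewrite eq_sym.
by move=> _; rewrite delta_tensmx_form mulmx1.
Qed.

Lemma adj_tensmx (A : 'M[C]_r) (B : 'M[C]_d) : (A *t B)^t* = A^t* *t B^t*.
Proof. by rewrite trmx_tens map_mxT. Qed.

Lemma sdp_feasibleP (Y : 'I_r -> 'M[C]_d) :
  sdp_feasible Y <->
  (forall i, psdmx (Y i)) /\ forall u, 0 <= sdp_gap Y u.
Proof.
split=> -[pY H]; split=> //.
  move=> u; have [_ /(_ (unblock u))] := H; rewrite sdp_gapE /sdp_gap.
  have -> : \sum_i block (unblock u) i = \sum_i u i.
    by apply: eq_bigr => i _; rewrite unblockK.
  by under eq_bigr do rewrite unblockK.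
split; last by move=> v; rewrite sdp_gapE.
apply/hermsymmxP; rewrite adjmxB; congr (_ - _).
  rewrite adjmx_sum; apply: eq_bigr => i _.
  by rewrite adj_tensmx trmx_delta map_delta_mx (adj_psdmx (pY i)).
rewrite adjmx_sum.
under eq_bigr do rewrite big_mkcond adjmx_sum /=.
(* The adjoint exchanges [i] and [j]; the condition [i != j] is symmetric, so swapping the sums
   restores the matrix. *)
rewrite exchange_big /=; apply: eq_bigr => j _.
rewrite [RHS]big_mkcond; apply: eq_bigr => i _; rewrite eq_sym.
case: ifP => _; last by rewrite trmx0 map_mx0.
by rewrite adj_tensmx trmx_delta map_delta_mx adjmx1.
Qed.

End BlockForm.

(** * Feasible points and their transfer from [sigma] to [rho] *)

Section SDP.
Variables (R : realType) (r d : nat).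
Implicit Types (Y rho sigma : 'I_r -> 'M[R[i]]_d) (u : 'I_r -> 'cV[R[i]]_d).

(** On a family supported at the single index [i] the two terms [|x|^2] cancel and the form of [Y i]
    remains. *)
Lemma psdmx_sdp_gap Y : (forall i, (Y i)^t* = Y i) ->
  (forall u, 0 <= sdp_gap Y u) -> forall i, psdmx (Y i).
Proof.
move=> hY gapY i; split; first exact/hermsymmxP/hY.
move=> x; have := gapY (fun j => if j == i then x else 0).
rewrite /sdp_gap -big_mkcond big_pred1_eq /=.
rewrite (bigD1 i) //= eqxx big1 ?addr0; last first.
  by move=> j /negPf ->; rewrite mulmx0 mxE.
by rewrite mulmxDr mulmxDl mulmx1 [X in X - _]mxE addrK.
Qed.

Lemma sdp_feasible_herm Y : (forall i, (Y i)^t* = Y i) ->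
  (forall u, 0 <= sdp_gap Y u) -> sdp_feasible Y.
Proof.
by move=> hY gapY; apply/sdp_feasibleP; split; [exact: psdmx_sdp_gap|].
Qed.

Lemma sdp_feasible_ex : (0 < r)%N -> exists Y, sdp_feasible Y.
Proof.
(* Here [Y_i + I = r I], which turns the constraint into [normsq_sum_le]. *)
move=> r0; exists (fun _ => (r%:R - 1)%:M); apply: sdp_feasible_herm.
  move=> _; rewrite tr_scalar_mx map_scalar_mx.
  by congr _%:M; rewrite rmorphB rmorph1 rmorph_nat.
move=> u; rewrite /sdp_gap subr_ge0; apply: le_trans (normsq_sum_le u) _.
rewrite mulr_sumr le_eqVlt; apply/orP; left; apply/eqP; apply: eq_bigr => i _.
rewrite -raddfD subrK mul_mx_scalar -scalemxAl [RHS]mxE. 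
congr (_ * _).
Qed.

Lemma sdp_transfer rho sigma (f : 'I_r -> R) (a b e : R) :
  (forall i, quantum_state (rho i)) -> (forall i, quantum_state (sigma i)) ->
  (forall i, exists2 V, psdmx (1%:M - V *m V^t*) &
    complex.Re (\tr (V^t* *m (sqrtmx (sigma i) *m sqrtmx (rho i)))) = f i) ->
  a ^+ 2 - b ^+ 2 = 1 -> 0 < e ->
  forall Y, sdp_feasible Y -> exists2 Y', sdp_feasible Y' &
    \sum_i complex.Re (\tr (Y' i *m rho i)) <=
    \sum_i complex.Re (\tr (Y i *m sigma i))
    + r%:R * \sum_i (a ^+ 2 + b ^+ 2 - a * b * f i *+ 2 + e).
Proof.
move=> srho ssigma hV ab e0 Y /sdp_feasibleP [pY gapY].
have /fin_all_exists [A /fin_all_exists [B AB]] : forall i, exists A B,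
  [/\ B \in unitmx, psdmx (B *m B^t* - rho i), psdmx (sigma i - A *m A^t*)
    & complex.Re (\tr ((a%:C *: B - b%:C *: A)^t* *m (a%:C *: B - b%:C *: A)))
      <= a ^+ 2 + b ^+ 2 - a * b * f i *+ 2 + e].
  move=> i; have [V pV <-] := hV i.
  exact: contraction_factors.
pose X i := a%:C *: B i - b%:C *: A i.
pose Z i := Y i + 1%:M.
pose G i := (A i)^t* *m Z i *m A i + r%:R *: ((X i)^t* *m X i).
pose N i := invmx (B i).
pose Z' i := (N i)^t* *m G i *m N i.
have pZ i : psdmx (Z i) by apply: psdmxD (pY i) (psdmx1 _ _).
have pG i : psdmx (G i).
  by apply: psdmxD (psdmx_conj _ (pZ i)) (psdmxZ _ (psdmx_gram _)).
have pZ' i : psdmx (Z' i) by exact: psdmx_conj.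
have NB i : N i *m B i = 1%:M by have [uB _ _ _] := AB i; exact: mulVmx.
have BN i : B i *m N i = 1%:M by have [uB _ _ _] := AB i; exact: mulmxV.
exists (fun i => Z' i - 1%:M).
  apply: sdp_feasible_herm => [i|u].
    by rewrite adjmxB adjmx1 (adj_psdmx (pZ' i)).
  (* With [w_i = B_i^{-1} u_i] one has [u_i = B_i w_i] and [v_i = A_i w_i], hence
     [X_i w_i = a u_i - b v_i]. *)
  pose v i := A i *m (N i *m u i).
  have Z'E i : ((u i)^t* *m (Z' i - 1%:M + 1%:M) *m u i) 0 0 =
     ((v i)^t* *m Z i *m v i) 0 0 +
     r%:R * ((a%:C *: u i - b%:C *: v i)^t* *m (a%:C *: u i - b%:C *: v i)) 0 0.
    have -> : a%:C *: u i - b%:C *: v i = X i *m (N i *m u i).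
      rewrite mulmxBl -!scalemxAl -/(v i) (mulmxA (B i)) BN mul1mx.
      by [].
    rewrite subrK /Z' /G /v mulmxDr mulmxDl mulmxDr mulmxDl [LHS]mxE.
    rewrite -scalemxAr -scalemxAl -scalemxAr -scalemxAl [X in _ + X]mxE.
    by rewrite !adjmxM !mulmxA.
  rewrite /sdp_gap (eq_bigr _ (fun i _ => Z'E i)) big_split /= -mulr_sumr.
  have := gapY v; rewrite /sdp_gap !subr_ge0 => gapv.
  have aR : a%:C \is Num.real by rewrite complex_real.
  have bR : b%:C \is Num.real by rewrite complex_real.
  have abC : a%:C ^+ 2 - b%:C ^+ 2 = 1 :> R[i].
    by rewrite -!rmorphXn -rmorphB ab rmorph1.
  (* The old constraint at [v] bounds [|sum_i v_i|^2]; the hyperbolic inequality carries this over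
     to [|sum_i u_i|^2]. *)
  apply: le_trans (normsq_hyperbolic (\sum_i u i) (\sum_i v i) aR bR abC) _.
  apply: lerD gapv _; rewrite !scaler_sumr -sumrB.
  exact: normsq_sum_le.
rewrite mulr_sumr -big_split /=; apply: ler_sum => i _.
have [uB pB pA XX] := AB i.
(* Replacing [rho i] by the larger [B_i B_i^*] cancels the inverses in [Z']. *)
have h1 : complex.Re (\tr (Z' i *m rho i)) <= complex.Re (\tr (G i)).
  have -> : \tr (G i) = \tr (Z' i *m (B i *m (B i)^t*)).
    rewrite /Z' mulmxA -(mulmxA _ (N i)) NB mulmx1 mxtrace_mulC mulmxA.
    by rewrite -adjmxM NB adjmx1 mul1mx.
  have := Re_ge0 (tr_mul_psdmx_ge0 (pZ' i) pB).
  by rewrite mulmxBr mxtraceB ReD ReN subr_ge0.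
have h2 : complex.Re (\tr (G i)) <= complex.Re (\tr (Z i *m sigma i))
    + r%:R * complex.Re (\tr ((X i)^t* *m X i)).
  rewrite /G mxtraceD mxtraceZ ReD -(rmorph_nat (real_complex R)) ReZ lerD2r.
  rewrite mxtrace_mulC mulmxA mxtrace_mulC.
  have := Re_ge0 (tr_mul_psdmx_ge0 (pZ i) pA).
  by rewrite mulmxBr mxtraceB ReD ReN subr_ge0.
(* Both shifts by the identity change the value by a unit trace, so they cancel. *)
have h3 : complex.Re (\tr (Z i *m sigma i)) = complex.Re (\tr (Y i *m sigma i)) + 1.
  by rewrite mulmxDl mul1mx mxtraceD (ssigma i).2 ReD.
have h4 : complex.Re (\tr ((Z' i - 1%:M) *m rho i)) =
    complex.Re (\tr (Z' i *m rho i)) - 1.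
  by rewrite mulmxBl mul1mx mxtraceB (srho i).2 ReD ReN.
rewrite h4 lerBlDr; apply: le_trans h1 (le_trans h2 _).
by rewrite h3 addrAC lerD2r lerD2l ler_wpM2l.
Qed.

End SDP.

(** * One-sided comparison of the two infima *)

Section Continuity.
Variables (R : realType) (r d : nat).
Implicit Types (Y rho sigma : 'I_r -> 'M[R[i]]_d).

Definition sdp_values rho : set R :=
  [set x : R | exists2 Y : 'I_r -> 'M[R[i]]_d, sdp_feasible Y &
                     x = \sum_(i < r) complex.Re (\tr (Y i *m rho i))]%classic.

Lemma sdp_values_lbound rho : (forall i, quantum_state (rho i)) ->
  has_lbound (sdp_values rho).
Proof.
move=> srho; exists 0 => _ [Y [pY _] ->]; apply: sumr_ge0 => i _.
by apply: Re_ge0; apply: tr_mul_psdmx_ge0 (pY i) (srho i).1.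
Qed.

Lemma inf_sdp_values_le rho sigma (f : 'I_r -> R) (a b c : R) : (0 < r)%N ->
  (forall i, quantum_state (rho i)) -> (forall i, quantum_state (sigma i)) ->
  (forall i, exists2 V, psdmx (1%:M - V *m V^t*) &
    complex.Re (\tr (V^t* *m (sqrtmx (sigma i) *m sqrtmx (rho i)))) = f i) ->
  r%:R * c <= \sum_i f i -> 0 <= a * b -> a ^+ 2 - b ^+ 2 = 1 ->
  inf (sdp_values rho) <=
    inf (sdp_values sigma) + r%:R ^+ 2 * (a ^+ 2 + b ^+ 2 - a * b * c *+ 2).
Proof.
move=> r0 srho ssigma hV cf ab0 ab; rewrite -lerBlDr; apply: lb_le_inf.
  by have [Y fY] := sdp_feasible_ex R d r0; eexists; exists Y.
move=> _ [Y fY ->]; rewrite lerBlDr; apply/ler_addgt0Pr => e e0.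
have r2 : 0 < r%:R ^+ 2 :> R by rewrite exprn_gt0 // ltr0n.
(* The slack [e'] enters once per index and is multiplied by [r], for a total of [r^2 e']. *)
have [e' e0' ->] : exists2 e', 0 < e' & e = r%:R ^+ 2 * e'.
  by exists (e / r%:R ^+ 2); rewrite ?divr_gt0 // mulrC divfK // gt_eqF.
have [Y' fY' Y'le] := sdp_transfer srho ssigma hV ab e0' fY.
apply: le_trans (ge_inf (sdp_values_lbound srho) _) _; first by exists Y'.
apply: le_trans Y'le _; rewrite -addrA lerD2l.
rewrite -mulrDr [X in _ <= X * _]expr2 -[leRHS]mulrA ler_wpM2l ?ler0n //.
have -> : \sum_i (a ^+ 2 + b ^+ 2 - a * b * f i *+ 2 + e')
    = r%:R * (a ^+ 2 + b ^+ 2 + e') - a * b * (\sum_i f i) *+ 2.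
  under eq_bigr do rewrite addrAC.
  rewrite sumrB sumrMnl -mulr_sumr sumr_const card_ord.
  by rewrite [r%:R * _]mulr_natl.
(* The sign of [a * b] lets the sum of the [f i] be replaced by its lower bound. *)
have := ler_wpM2l ab0 cf; move: (r%:R) (\sum_i f i) => x y; nra.
Qed.

End Continuity.

(** * Optimisation over the hyperbola and the final bound *)

Lemma hyperbolic_param (R : rcfType) (s : R) : 1 <= s ->
  exists a b : R, [/\ 0 <= a * b, a ^+ 2 - b ^+ 2 = 1 &
    forall eps, a ^+ 2 + b ^+ 2 - a * b * (1 - eps) *+ 2 =
                (s * eps + (2 - eps) / s) / 2].
Proof.
move=> s1; have s0 : 0 < s by apply: lt_le_trans s1.
(* [a] and [b] are the hyperbolic cosine and sine of [log t]; [s >= 1] makes their product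
   nonnegative. *)
pose t := Num.sqrt s; have tt : t ^+ 2 = s by rewrite sqr_sqrtr // ltW.
have t0 : t != 0 by rewrite gt_eqF // sqrtr_gt0.
have sn0 : s != 0 by rewrite gt_eqF.
have abE : ((t + t^-1) / 2) * ((t - t^-1) / 2) = (s - s^-1) / 4.
  by rewrite -tt; field.
exists ((t + t^-1) / 2), ((t - t^-1) / 2); split.
- rewrite abE divr_ge0 // subr_ge0; apply: le_trans (s1).
  by rewrite invf_le1.
- by field.
- by move=> eps; rewrite -tt; field.
Qed.

(* The optimal choice is [s = sqrt ((2 - eps) / eps)]; at [eps = 0] the infimum
   over [s] is not attained. *)
Lemma le_sqrt_of_hyperbolic (R : rcfType) (D k eps : R) : 0 <= k -> 0 <= eps <= 1 ->
  (forall s, 1 <= s -> D <= k * ((s * eps + (2 - eps) / s) / 2)) ->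
  D <= k * Num.sqrt (eps * (2 - eps)).
Proof.
move=> k0 /andP [eps0 eps1] H; have [eps_eq0|epsN0] := eqVneq eps 0.
  rewrite eps_eq0 mul0r sqrtr0 mulr0 leNgt; apply/negP => D0.
  (* At [eps = 0] the hypothesis reads [D <= k / s]; this [s] turns it into [D + k <= k]. *)
  have s1 : 1 <= 1 + k / D by rewrite lerDl divr_ge0 // ltW.
  have s0 : 0 < 1 + k / D by apply: lt_le_trans s1.
  have := H _ s1; rewrite eps_eq0 mulr0 add0r subr0 mulrAC divff ?pnatr_eq0 // mul1r.
  rewrite ler_pdivlMr // mulrDr mulr1 mulrCA divff ?gt_eqF // mulr1.
  by rewrite gerDr leNgt D0.
have e0 : 0 < eps by rewrite lt_neqAle eq_sym epsN0.
set q := Num.sqrt _.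
have qq : q ^+ 2 = eps * (2 - eps) by rewrite sqr_sqrtr // mulr_ge0 // subr_ge0; lra.
have q0 : 0 < q by rewrite sqrtr_gt0 mulr_gt0 // subr_gt0; lra.
have eq : eps <= q.
  by rewrite leNgt; apply/negP => qe; move: (q) q0 qq qe => x x0 xx xe; nra.
(* [q / eps] is the optimal [s]: it makes both summands equal to [q]. *)
have s1 : 1 <= q / eps by rewrite ler_pdivlMr // mul1r.
have := H _ s1.
suff -> : (q / eps * eps + (2 - eps) / (q / eps)) / 2 = q by [].
have -> : (2 - eps) / (q / eps) = q.
  by rewrite invf_div mulrCA mulrA -qq expr2 mulfK // gt_eqF.
by rewrite divfK //; field.
Qed.

Theorem mainTheorem8 (R : realType) (d r : nat) (hr : (2 <= r)%N)
    (rho sigma : 'I_r -> 'M[R[i]]_d)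
    (hrho : forall i, quantum_state (rho i))
    (hsigma : forall i, quantum_state (sigma i))
    (eps : R) (heps : 0 <= eps <= 1)
    (hF : r%:R^-1 * \sum_(i < r) fidelity (rho i) (sigma i) >= 1 - eps) :
  `|sdp_fidelity rho - sdp_fidelity sigma|
    <= r%:R / (r%:R - 1) * Num.sqrt (eps * (2 - eps)).
Proof.
have r0 : (0 < r)%N by apply: ltn_trans hr.
have rR : 0 < r%:R :> R by rewrite ltr0n.
have rR1 : 0 < r%:R - 1 :> R by rewrite subr_gt0 ltr1n.
have cf : r%:R * (1 - eps) <= \sum_i fidelity (rho i) (sigma i).
  by move: hF; rewrite mulrC ler_pdivlMr // mulrC.
rewrite /sdp_fidelity -/(sdp_values rho) -/(sdp_values sigma) -mulrBr normrM.
have k0 : 0 <= (r%:R * (r%:R - 1))^-1 :> R by rewrite invr_ge0 mulr_ge0 // ltW.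
rewrite (ger0_norm k0).
have -> : r%:R / (r%:R - 1) * Num.sqrt (eps * (2 - eps)) =
  (r%:R * (r%:R - 1))^-1 * (r%:R ^+ 2 * Num.sqrt (eps * (2 - eps))).
  by field; rewrite !gt_eqF.
apply: ler_wpM2l k0 _ _ _.
(* Each sign of the difference is a one-sided comparison valid for every [s >= 1]; the first has
   [rho] and [sigma] exchanged. *)
rewrite ler_norml lerNl opprB; apply/andP; split;
  apply: le_sqrt_of_hyperbolic => // [|s /hyperbolic_param [a [b [ab0 ab <-]]]];
  rewrite ?sqr_ge0 // lerBlDl.
- apply: (inf_sdp_values_le r0 hsigma hrho _ cf) => // i.
  exact: fidelity_contractionr (hrho i).1 (hsigma i).1.
- apply: (inf_sdp_values_le r0 hrho hsigma _ cf) => // i.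
  exact: fidelity_contractionl (hrho i).1 (hsigma i).1.
Qed.
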